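(* For $p\in\{012,001\}$, we have $$C_p(x,y)=\frac{1-x+x^2-x^2y}{1-2x+x^2-x^2y}.$$
   Context: A Catalan word of length $n\geq 1$ is a word $w_1\ldots w_n$ over the non-negative integers with $w_1=0$ and $0\leq w_i\leq w_{i-1}+1$ for $2\leq i\leq n$; the empty word is the unique Catalan word of length $0$. A word $w$ contains the pattern $p=p_1\ldots p_k$ if there are indices $i_1<\cdots<i_k$ such that $w_{i_1}\ldots w_{i_k}$ is order-isomorphic to $p$ (for all $a,b$: $w_{i_a}<w_{i_b}$ iff $p_a<p_b$, and $w_{i_a}=w_{i_b}$ iff $p_a=p_b$); otherwise $w$ avoids $p$. $\mathcal{C}_n(p)$ is the set of Catalan words of length $n$ avoiding $p$. A descent of $w$ is an index $i$ with $w_i>w_{i+1}$. $C_p(x,y)=\sum_{n,k\geq 0}c_{n,k}x^ny^k$, where $c_{n,k}$ is the number of words in $\mathcal{C}_n(p)$ with exactly $k$ descents. *)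

(* Defs.v *)
From HB Require Import structures.
From mathcomp Require Import all_boot all_order all_algebra.
From mathcomp Require Import boolp.

Set Implicit Arguments.
Unset Strict Implicit.
Unset Printing Implicit Defensive.

Import GRing.Theory.
Local Open Scope ring_scope.

(* Formal power series over a commutative ring: f n is the coefficient of the
   n-th power of the variable.  The ring structure is the Cauchy product, and a
   series is a unit exactly when its constant term is, so that {fps {fps R}}
   (series in x whose coefficients are series in y) is again such a ring and
   "/" has its usual meaning there. *)
Record fps (R : Type) := Fps { fps_coef :> nat -> R }.

Notation "{ 'fps' R }" := (fps R) (at level 0, format "{ 'fps'  R }").

Lemma fpsP (R : Type) (f g : {fps R}) : f =1 g -> f = g.
Proof. by case: f g => [f] [g] /= /funext ->. Qed.

HB.instance Definition _ (R : Type) := gen_eqMixin {fps R}.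
HB.instance Definition _ (R : Type) := gen_choiceMixin {fps R}.

Section FpsZmod.
Variable R : zmodType.
Implicit Types f g h : {fps R}.

Definition fps_zero : {fps R} := Fps (fun=> 0).
Definition fps_opp f : {fps R} := Fps (fun n => - f n).
Definition fps_add f g : {fps R} := Fps (fun n => f n + g n).

Fact fps_addA : associative fps_add.
Proof. by move=> f g h; apply: fpsP => n /=; rewrite addrA. Qed.
Fact fps_addC : commutative fps_add.
Proof. by move=> f g; apply: fpsP => n /=; rewrite addrC. Qed.
Fact fps_add0 : left_id fps_zero fps_add.
Proof. by move=> f; apply: fpsP => n /=; rewrite add0r. Qed.
Fact fps_addN : left_inverse fps_zero fps_opp fps_add.
Proof. by move=> f; apply: fpsP => n /=; rewrite addNr. Qed.

HB.instance Definition _ :=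
  GRing.isZmodule.Build {fps R} fps_addA fps_addC fps_add0 fps_addN.

End FpsZmod.

Section FpsRing.
Variable R : comNzRingType.
Implicit Types f g h : {fps R}.

Definition fps_const (c : R) : {fps R} := Fps (fun n => if n == 0%N then c else 0).
Definition fps_var : {fps R} := Fps (fun n => (n == 1%N)%:R).
Definition fps_mul f g : {fps R} :=
  Fps (fun n => \sum_(i < n.+1) f i * g (n - i)%N).

Let trunc N f : {poly R} := \poly_(i < N) f i.

Local Lemma coef_trunc_mul N f g n : (n < N)%N ->
  (trunc N f * trunc N g)`_n = fps_mul f g n.
Proof.
move=> ltnN; rewrite coefM; apply: eq_bigr => i _; rewrite !coef_poly.
by rewrite (leq_ltn_trans (leq_subr _ _) ltnN) (leq_ltn_trans _ ltnN) // -ltnS.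
Qed.

Fact fps_mulC : commutative fps_mul.
Proof.
move=> f g; apply: fpsP => n.
by rewrite -!(@coef_trunc_mul n.+1) // mulrC.
Qed.

Fact fps_mulA : associative fps_mul.
Proof.
move=> f g h; apply: fpsP => n.
have E1 : fps_mul f (fps_mul g h) n
    = (trunc n.+1 f * (trunc n.+1 g * trunc n.+1 h))`_n.
  rewrite coefM; apply: eq_bigr => i _.
  by rewrite (@coef_trunc_mul n.+1) ?coef_poly ?ltn_ord // ltnS leq_subr.
have E2 : fps_mul (fps_mul f g) h n
    = (trunc n.+1 f * trunc n.+1 g * trunc n.+1 h)`_n.
  rewrite coefM; apply: eq_bigr => i _.
  by rewrite (@coef_trunc_mul n.+1) ?coef_poly ?ltn_ord // ltnS leq_subr.
by rewrite E1 E2 mulrA.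
Qed.

Fact fps_mul1 : left_id (fps_const 1) fps_mul.
Proof.
move=> f; apply: fpsP => n /=.
by rewrite big_ord_recl /= subn0 mul1r big1 ?addr0 // => i _; rewrite mul0r.
Qed.

Fact fps_mulDl : left_distributive fps_mul +%R.
Proof.
move=> f g h; apply: fpsP => n /=.
by rewrite -big_split; apply: eq_bigr => i _; rewrite mulrDl.
Qed.

Fact fps_1_neq0 : fps_const 1 != 0 :> {fps R}.
Proof.
by apply/eqP => /(congr1 (fun f : {fps R} => f 0%N)) /eqP; rewrite oner_eq0.
Qed.

HB.instance Definition _ := GRing.Zmodule_isComNzRing.Build {fps R}
  fps_mulA fps_mulC fps_mul1 fps_mulDl fps_1_neq0.

Lemma fpsM f g n : (f * g) n = \sum_(i < n.+1) f i * g (n - i)%N.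
Proof. by []. Qed.

Lemma fpsD f g n : (f + g) n = f n + g n. Proof. by []. Qed.

Lemma fpsN f n : (- f) n = - f n. Proof. by []. Qed.

Lemma fps1 n : (1 : {fps R}) n = (n == 0%N)%:R.
Proof. by rewrite /GRing.one /=; case: eqP. Qed.

Lemma fps_sum (I : Type) (r : seq I) (P : pred I) (F : I -> {fps R}) n :
  (\sum_(i <- r | P i) F i) n = \sum_(i <- r | P i) F i n.
Proof. by apply: (big_morph (fun f : {fps R} => f n)). Qed.

Lemma fps_exp_small f m n : f 0%N = 0 -> (n < m)%N -> (f ^+ m) n = 0.
Proof.
move=> f0; elim: m n => // m IH n; rewrite ltnS exprS => lenm.
rewrite fpsM big_ord_recl f0 mul0r add0r big1 // => i _.
rewrite IH ?mulr0 // lift0; case: n lenm i => [|n] lenm i; first by case: i.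
by rewrite subSS (leq_ltn_trans (leq_subr _ _)).
Qed.

End FpsRing.

Arguments fps_var {R}.

Section FpsUnitRing.
Variable R : comUnitRingType.
Implicit Types f g h : {fps R}.

Definition fps_unit : {pred {fps R}} := fun f => f 0%N \is a GRing.unit.

(* Geometric series: with u the constant term, f = u (1 - g) where g has zero
   constant term, hence 1/f = (1 + g + g^2 + ...) / u, and g^m does not
   contribute to the coefficients of index less than m. *)
Definition fps_inv f : {fps R} :=
  if f \in fps_unit then
    Fps (fun n => (f 0%N)^-1 *
      (\sum_(m < n.+1) (1 - fps_const (f 0%N)^-1 * f) ^+ m : {fps R}) n)
  else f.

Local Lemma fps_constM (c : R) f n : (fps_const c * f) n = c * f n.
Proof.
by rewrite fpsM big_ord_recl /= subn0 big1 ?addr0 // => i _; rewrite mul0r.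
Qed.

Fact fps_mulVx : {in fps_unit, left_inverse 1 fps_inv *%R}.
Proof.
move=> f uf; apply: fpsP => n; rewrite /fps_inv uf.
set u := f 0%N; set g := 1 - _.
have u_unit : u \is a GRing.unit := uf.
have g0 : g 0%N = 0.
  by rewrite /g fpsD fpsN fps1 fps_constM mulVr // subrr.
pose S : {fps R} := \sum_(m < n.+1) g ^+ m.
transitivity ((fps_const u^-1 * f * S) n); last first.
  have -> : fps_const u^-1 * f = 1 - g by rewrite /g opprB addrC subrK.
  rewrite /S -(opprB g 1) mulNr -subrX1 opprB fpsD fpsN.
  by rewrite fps_exp_small // subr0.
have -> : fps_const u^-1 * f * S = fps_const u^-1 * S * f by rewrite mulrAC.
rewrite !fpsM; apply: eq_bigr => i _; congr (_ * _).
rewrite fps_constM /=; congr (_ * _); rewrite /S !fps_sum.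
rewrite -(big_mkord xpredT (fun m => (g ^+ m) i)).
rewrite -(big_mkord xpredT (fun m => (g ^+ m) i)).
rewrite [RHS](@big_cat_nat _ _ _ i.+1) //=.
rewrite [X in _ = _ + X]big_nat_cond [X in _ = _ + X]big1 ?addr0 // => m.
by rewrite andbT => /andP[ltim _]; rewrite fps_exp_small.
Qed.

Fact fps_unitPl f g : g * f = 1 -> fps_unit f.
Proof.
move=> /(congr1 (fun h : {fps R} => h 0%N)).
rewrite fpsM big_ord_recl big_ord0 addr0 fps1 => gf.
by apply/unitrPr; exists (g 0%N); rewrite mulrC.
Qed.

Fact fps_invr_out : {in [predC fps_unit], fps_inv =1 id}.
Proof. by move=> f; rewrite inE /= /fps_inv => /negbTE ->. Qed.

HB.instance Definition _ := GRing.ComNzRing_hasMulInverse.Build {fps R}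
  fps_mulVx fps_unitPl fps_invr_out.

End FpsUnitRing.

Local Open Scope nat_scope.

Definition catalan (w : seq nat) : bool :=
  (head 0 w == 0) && sorted (fun a b => b <= a.+1) w.

Definition contains (w p : seq nat) : bool :=
  [exists i : {ffun 'I_(size p) -> 'I_(size w)},
    [forall a : 'I_(size p), forall b : 'I_(size p), (a < b) ==> (i a < i b)] &&
    [forall a : 'I_(size p), forall b : 'I_(size p),
      ((nth 0 w (i a) < nth 0 w (i b)) == (nth 0 p a < nth 0 p b)) &&
      ((nth 0 w (i a) == nth 0 w (i b)) == (nth 0 p a == nth 0 p b))]].

Definition avoids (w p : seq nat) : bool := ~~ contains w p.

Definition descents (w : seq nat) : nat :=
  #|[set i : 'I_(size w).-1 | nth 0 w i.+1 < nth 0 w i]|.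

(* The letters of a Catalan word of length n are smaller than n, so it loses
   nothing to look for these words among the tuples over 'I_n. *)
Lemma catalan_bound (w : seq nat) : catalan w -> all (ltn^~ (size w)) w.
Proof.
case/andP => /eqP w0 w_sorted; apply/(all_nthP 0).
suff le_nth i : i < size w -> nth 0 w i <= i.
  by move=> i lti; apply: leq_ltn_trans (le_nth _ lti) lti.
elim: i => [|i IH] lti; first by rewrite nth0 w0.
apply: leq_trans (_ : (nth 0 w i).+1 <= _); last by rewrite ltnS IH // ltnW.
by move/(sortedP 0): w_sorted; apply.
Qed.

Definition catalan_avoiders (p : seq nat) (n : nat) : {set n.-tuple 'I_n} :=
  [set w : n.-tuple 'I_n |
    catalan (map val w) && avoids (map val w) p].

Definition catalan_count (p : seq nat) (n k : nat) : nat :=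
  #|[set w in catalan_avoiders p n | descents (map val w) == k]|.

Local Open Scope ring_scope.

Definition catalan_gf (p : seq nat) : {fps {fps int}} :=
  Fps (fun n => Fps (fun k => (catalan_count p n k)%:Z)).

Definition var_x : {fps {fps int}} := fps_var.
Definition var_y : {fps {fps int}} := fps_const fps_var.

(* Main.v *)
(** Let [A_n] and [B_n] be the generating polynomials in [y], counting descents,
of the avoiders of length [n + 1] that end in [0], respectively in a nonzero
letter.  For both patterns every avoider of length at least 2 arises uniquely
from a shorter nonempty one [u], either by appending a [0], or by a
descent-preserving operation whose result ends in a nonzero letter: [u] goes
to [u 1] for 012, and to [0 (u + 1)] for 001.  Appending [0] creates a descent
exactly when [u] ends in a nonzero letter, so that
[A_(n+1) = A_n + y B_n] and [B_(n+1) = A_n + B_n], which determines the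
generating function. *)

Require Import Defs.
From HB Require Import structures.
From mathcomp Require Import all_boot all_order all_algebra.
From mathcomp Require Import zify ring.

Import GRing.Theory.
Local Open Scope ring_scope.

(** * Powers of the variable in formal power series *)

Section FpsMonomials.
Variable R : comNzRingType.
Implicit Types f : {fps R}.

Lemma fps_varM f n : (fps_var * f) n = if n is m.+1 then f m else 0.
Proof.
case: n => [|n]; rewrite fpsM big_ord_recl /= mul0r add0r ?big_ord0 //.
rewrite big_ord_recl /= mul1r subSS subn0 big1 ?addr0 // => i _.
by rewrite mul0r.
Qed.

Lemma fps_varX d n : (fps_var ^+ d : {fps R}) n = (n == d)%:R.
Proof.
elim: d n => [|d IHd] n; first by rewrite expr0 fps1.
by rewrite exprS fps_varM; case: n => [|n] //=; rewrite IHd eqSS.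
Qed.

End FpsMonomials.

Local Open Scope nat_scope.

(** * Descents and the Catalan condition under extension of words *)

Lemma descents_sum (w : seq nat) :
  descents w = \sum_(i < (size w).-1) (nth 0 w i.+1 < nth 0 w i).
Proof.
rewrite /descents -sum1_card big_mkcond; apply: eq_bigr => i _.
by rewrite inE; case: ifP.
Qed.

Lemma descents_rcons (u : seq nat) x : u != [::] ->
  descents (rcons u x) = descents u + (x < last 0 u).
Proof.
case: u => // a u _; rewrite !descents_sum size_rcons /= big_ord_recr /=.
congr (_ + _); last first.
  by rewrite -rcons_cons !nth_rcons /= ltnSn ltnn eqxx (last_nth 0).
apply: eq_bigr => i _; rewrite -rcons_cons !nth_rcons /= ltnS ltn_ord.
by rewrite (ltnW (ltn_ord i)).
Qed.

(** The shift keeps all comparisons between neighbours, and the new leading 0 stands before a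
    positive letter, so it starts no descent. *)
Lemma descents_cons0_mapS (u : seq nat) :
  descents (0 :: map succn u) = descents u.
Proof.
rewrite !descents_sum /= size_map; case: u => [|a u]; first by rewrite !big_ord0.
rewrite /= big_ord_recl /= add0n; apply: eq_bigr => i _.
rewrite add0n -[_.+1 :: _]/(map succn (a :: u)).
by rewrite !(nth_map 0) /= ?ltnS ?(ltnW (ltn_ord i)).
Qed.

Lemma catalan_rcons (u : seq nat) x : u != [::] ->
  catalan (rcons u x) = catalan u && (x <= (last 0 u).+1).
Proof.
by case: u => // a u _; rewrite /catalan /= rcons_path andbA.
Qed.

Lemma catalan_cons0_mapS (u : seq nat) : u != [::] ->
  catalan (0 :: map succn u) = catalan u.
Proof.
case: u => // a u _.
by rewrite /catalan /= path_map ltnS leqn0.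
Qed.

(** * Occurrences of patterns of length three *)

Lemma contains3P (w : seq nat) a b c :
  reflect (exists i j k, [/\ i < j, j < k, k < size w &
    let p := [:: a; b; c] in let v := [:: nth 0 w i; nth 0 w j; nth 0 w k] in
    forall s t, s < 3 -> t < 3 ->
      ((nth 0 v s < nth 0 v t) = (nth 0 p s < nth 0 p t)) /\
      ((nth 0 v s == nth 0 v t) = (nth 0 p s == nth 0 p t))])
    (contains w [:: a; b; c]).
Proof.
apply: (iffP existsP) => [[f /andP[/forallP f_mono /forallP f_iso]]|].
  pose o s (lt : s < 3) := f (Ordinal lt).
  exists (o 0 isT), (o 1 isT), (o 2 isT); split => //=.
  - by apply: (implyP (forallP (f_mono _) _)).
  - by apply: (implyP (forallP (f_mono _) _)).
  move=> s t lts ltt.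
  move/forallP/(_ (Ordinal ltt))/andP: (f_iso (Ordinal lts)) => [/eqP <- /eqP <-].
  have oE r (ltr : r < 3) :
      nth 0 [:: nth 0 w (o 0 isT); nth 0 w (o 1 isT); nth 0 w (o 2 isT)] r
      = nth 0 w (f (Ordinal ltr)).
    case: r ltr => [|[|[|//]]] ltr /=; rewrite /o; congr (nth 0 w (f _));
      exact: val_inj.
  by rewrite !oE.
move=> [i [j [k [ltij ltjk ltk iso]]]].
have ltj := ltn_trans ltjk ltk; have lti := ltn_trans ltij ltj.
pose g (s : 'I_3) := nth (Ordinal lti) [:: Ordinal lti; Ordinal ltj; Ordinal ltk] s.
exists [ffun s => g s]; apply/andP; split.
  apply/forallP => s; apply/forallP => t; apply/implyP; rewrite !ffunE /g.
  case: s t => [[|[|[|//]]] /= ?] [[|[|[|//]]] /= ?] //= _.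
  exact: ltn_trans ltij ltjk.
have gE s : nth 0 w (g s) = nth 0 [:: nth 0 w i; nth 0 w j; nth 0 w k] s.
  by case: s => [[|[|[|//]]]].
apply/forallP => s; apply/forallP => t; rewrite !ffunE !gE.
by have [-> ->] := iso s t (ltn_ord s) (ltn_ord t); rewrite !eqxx.
Qed.

Lemma contains012P (w : seq nat) :
  reflect (exists i j k, [/\ i < j, j < k, k < size w,
      nth 0 w i < nth 0 w j & nth 0 w j < nth 0 w k])
    (contains w [:: 0; 1; 2]).
Proof.
apply: (iffP (contains3P _ _ _ _)) => -[i [j [k]]].
  move=> [ij jk kw iso]; exists i, j, k; split=> //.
    by have [/= ->] := iso 0 1 isT isT.
  by have [/= ->] := iso 1 2 isT isT.
move=> [ij jk kw wij wjk]; exists i, j, k; split=> //.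
by move=> q v [|[|[|//]]] [|[|[|//]]] _ _ /=; split; lia.
Qed.

Lemma contains001P (w : seq nat) :
  reflect (exists i j k, [/\ i < j, j < k, k < size w,
      nth 0 w i = nth 0 w j & nth 0 w j < nth 0 w k])
    (contains w [:: 0; 0; 1]).
Proof.
apply: (iffP (contains3P _ _ _ _)) => -[i [j [k]]].
  move=> [ij jk kw iso]; exists i, j, k; split=> //.
    by apply/eqP; have [_ /= ->] := iso 0 1 isT isT.
  by have [/= ->] := iso 1 2 isT isT.
move=> [ij jk kw wij wjk]; exists i, j, k; split=> //.
by move=> q v [|[|[|//]]] [|[|[|//]]] _ _ /=; split; lia.
Qed.

(** Letters rise by at most 1, so the first letter above 1 comes right after a 1, and together with
    the initial 0 these two form 012. Conversely, 012 needs three distinct values. *)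
Lemma catalan_avoids012 (w : seq nat) :
  catalan w && avoids w [:: 0; 1; 2] = (head 0 w == 0) && all (leq^~ 1) w.
Proof.
apply/idP/idP => [/andP[/andP[w0 w_step] av]|/andP[w0 le1]].
  rewrite w0 /=; apply: contraT; rewrite -has_predC => has2.
  have lti := has2; rewrite has_find in lti.
  have /= := nth_find 0 has2; rewrite -ltnNge.
  case E : (find _ w) lti => [|i] lti wi; first by rewrite nth0 (eqP w0) in wi.
  have := @before_find _ 0 (predC (leq^~ 1)) w i; rewrite E => /(_ (ltnSn i)).
  move/negbFE => /= wi1; move/(sortedP 0): w_step => /(_ i lti) wSi.
  (* If the letter before the first large one is the initial 0, the Catalan step bound fails;
     otherwise that letter is a 1 at a positive position. *)
  case: i => [|i] in E lti wi wi1 wSi *.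
    by rewrite [nth 0 w 0]nth0 (eqP w0) in wSi; lia.
  case/contains012P: av; exists 0, i.+1, i.+2.
  by split=> //; rewrite ?nth0 ?(eqP w0); lia.
(* Past the end of [w] the default value 0 satisfies the bound too. *)
have le_nth i : nth 0 w i <= 1.
  have [lti|gei] := ltnP i (size w); last by rewrite nth_default.
  exact: (all_nthP 0 le1).
apply/andP; split; last first.
  apply/contains012P => -[i [j [k [_ _ _ wij wjk]]]].
  by have := le_nth k; lia.
rewrite /catalan w0; apply/(sortedP 0) => i _.
exact: leq_trans (le_nth _) _.
Qed.

(** * Avoiders generated by appending 0 and by an abstract operation [grow] *)

Section Avoiders.
Variables (p : seq nat) (grow : seq nat -> seq nat).
Let good w := catalan w && avoids w p.

Hypothesis good_nil : good [::].
Hypothesis good_0 : good [:: 0].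
Hypothesis good_rcons0 : forall u, u != [::] -> good u -> good (rcons u 0).
Hypothesis good_grow : forall u, u != [::] -> good u -> good (grow u).
Hypothesis good_inv : forall w, 1 < size w -> good w ->
  exists2 u, good u & w = rcons u 0 \/ w = grow u.
Hypothesis size_grow : forall u, size (grow u) = (size u).+1.
Hypothesis grow_inj : injective grow.
Hypothesis last_grow : forall u, u != [::] -> last 0 (grow u) != 0.
Hypothesis descents_grow : forall u, u != [::] -> good u ->
  descents (grow u) = descents u.

(* Indexed so that [avoiders n] lists the words of length [n + 1]. *)
Fixpoint avoiders n : seq (seq nat) :=
  if n is m.+1 then
    map (rcons^~ 0) (avoiders m) ++ map grow (avoiders m)
  else [:: [:: 0]].

Lemma mem_avoiders n w : (w \in avoiders n) = good w && (size w == n.+1).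
Proof.
elim: n w => [|n IHn] w.
  rewrite inE; apply/eqP/andP => [->|[]]; first by rewrite good_0.
  by case: w => [|a []] // /andP[/andP[/eqP /= -> _] _].
rewrite mem_cat; apply/orP/andP => [[] /mapP[u]|[w_good /eqP w_size]].
- rewrite IHn => /andP[u_good /eqP u_size] ->.
  by rewrite good_rcons0 -?size_eq0 ?u_size // size_rcons u_size.
- rewrite IHn => /andP[u_good /eqP u_size] ->.
  by rewrite good_grow -?size_eq0 ?u_size // size_grow u_size.
have [|u u_good [] w_def] := good_inv w _ w_good; first by rewrite w_size.
  left; apply/mapP; exists u => //; rewrite IHn u_good -eqSS.
  by rewrite -w_size w_def size_rcons eqxx.
right; apply/mapP; exists u => //; rewrite IHn u_good -eqSS.
by rewrite -w_size w_def size_grow eqxx.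
Qed.

Lemma avoiders_neq0 n u : u \in avoiders n -> u != [::].
Proof. by rewrite mem_avoiders -size_eq0 => /andP[_ /eqP ->]. Qed.

Lemma avoiders_good n u : u \in avoiders n -> good u.
Proof. by rewrite mem_avoiders => /andP[]. Qed.

(** Both operations are injective, and the last letter, zero or nonzero, separates their images. *)
Lemma avoiders_uniq n : uniq (avoiders n).
Proof.
elim: n => //= n IHn; rewrite cat_uniq (map_inj_uniq (@rcons_injl _ 0)).
rewrite (map_inj_uniq grow_inj) IHn andbT; apply/hasPn => w /mapP[u u_in ->]; apply/mapP => -[v _ uv].
by have := last_grow u (avoiders_neq0 n u u_in); rewrite uv last_rcons.
Qed.

(** * Descent polynomials and their recurrence *)

Local Open Scope ring_scope.

(** Moves the count from tuples over ['I_n] to any duplicate-free list of the same words;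
    [catalan_bound] ensures that no word is lost. *)
Lemma catalan_gf_coef n (L : seq (seq nat)) : uniq L ->
  (forall w, (w \in L) = good w && (size w == n)) ->
  catalan_gf p n = \sum_(w <- L) fps_var ^+ descents w.
Proof.
move=> L_uniq memL; apply: fpsP => k; rewrite fps_sum /=.
have /permPr E : perm_eq L
      [seq map val (w : n.-tuple 'I_n) | w <- enum (catalan_avoiders p n)].
  apply: uniq_perm => //.
    rewrite map_inj_uniq ?enum_uniq // => s t /inj_map st.
    by apply: val_inj; apply: st; apply: val_inj.
  move=> w; rewrite memL.
  apply/andP/mapP => [[w_good /eqP w_size]|[t]]; last first.
    by rewrite mem_enum inE => t_good ->; rewrite size_map size_tuple.
  have /andP[w_cat _] := w_good.
  have w_lt := catalan_bound w_cat; rewrite w_size in w_lt.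
  (* All letters are below [n], so [insub] succeeds on each of them and [pmap] drops none. *)
  have wE : map val (pmap (insub : nat -> option 'I_n) w) = w.
    rewrite (@pmap_filter _ _ _ _ (insubK _)) //; apply/all_filterP.
    by apply: sub_all w_lt => i lti; rewrite isSome_insub.
  have s_size : size (pmap (insub : nat -> option 'I_n) w) == n.
    by rewrite -(size_map val) wE w_size.
  by exists (Tuple s_size); rewrite /= ?mem_enum ?inE /= wE.
rewrite (perm_big _ (introT permPr E)) big_map big_enum.
under eq_bigr do rewrite fps_varX.
rewrite -natr_sum natz /catalan_count -sum1_card; congr Posz.
under eq_bigl do rewrite inE.
by rewrite big_mkcondr; apply: eq_bigr => w _; rewrite eq_sym; case: eqP.
Qed.

(** With [P] equal to [ends0] and to [predC ends0] this is $A_n$ and $B_n$ respectively. *)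
Let weight (P : pred (seq nat)) n : {fps int} :=
  \sum_(w <- avoiders n | P w) fps_var ^+ descents w.
Let ends0 w := last 0%N w == 0%N.

Lemma weight_all n : weight xpredT n = weight ends0 n + weight (predC ends0) n.
Proof. exact: bigID. Qed.

Lemma weight_ends0S n :
  weight ends0 n.+1 = weight ends0 n + fps_var * weight (predC ends0) n.
Proof.
rewrite {1}/weight /= big_cat /= [X in _ + X]big1_seq ?addr0; last first.
  move=> w /andP[w0 /mapP[u u_in wu]].
  by have := last_grow u (avoiders_neq0 n u u_in); rewrite -wu; case/negP.
rewrite big_map (eq_bigl xpredT); last by move=> u; rewrite /ends0 last_rcons.
rewrite (bigID ends0) /= mulr_sumr; congr (_ + _).
  rewrite big_seq_cond [RHS]big_seq_cond; apply: eq_bigr => u /andP[u_in u0].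
  by rewrite descents_rcons ?(avoiders_neq0 n) // (eqP u0) addn0.
rewrite big_seq_cond [RHS]big_seq_cond; apply: eq_bigr => u /andP[u_in u0].
by rewrite descents_rcons ?(avoiders_neq0 n) // lt0n u0 addn1 exprS.
Qed.

Lemma weight_not_ends0S n : weight (predC ends0) n.+1 = weight xpredT n.
Proof.
rewrite {1}/weight /= big_cat /= [X in X + _]big1_seq ?add0r; last first.
  by move=> w /andP[w0 /mapP[u u_in wu]]; rewrite /ends0 wu last_rcons in w0.
rewrite big_map big_seq_cond [RHS]big_seq_cond.
apply: eq_big => [u|u /andP[u_in _]].
  case: (boolP (u \in _)) => //= u_in.
  by rewrite /ends0 last_grow // (avoiders_neq0 n).
by rewrite descents_grow ?(avoiders_neq0 n) // (avoiders_good n).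
Qed.

Lemma catalan_gf0 : catalan_gf p 0%N = 1.
Proof.
rewrite (@catalan_gf_coef 0 [:: [::]]) // => [|w].
  by rewrite big_seq1 descents_sum big_ord0 expr0.
by case: w => [|a w]; rewrite inE ?good_nil ?andbF.
Qed.

Lemma catalan_gfS n : catalan_gf p n.+1 = weight xpredT n.
Proof. exact: (catalan_gf_coef _ _ (avoiders_uniq n) (mem_avoiders n)). Qed.

Lemma catalan_gf1 : catalan_gf p 1%N = 1.
Proof.
by rewrite catalan_gfS /weight big_seq1 descents_sum big_ord0 expr0.
Qed.

Lemma catalan_gf2 : catalan_gf p 2 = 2.
Proof.
rewrite catalan_gfS weight_all weight_ends0S weight_not_ends0S /weight.
by rewrite !big_cons !big_nil /= descents_sum big_ord0; ring.
Qed.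

(** Put $T_n = A_n + B_n$. Since $B_{n+1} = T_n$, also $A_{n+1} = T_{n+1} - T_n$, and substituting
    both into $T_{n+2} = A_{n+1} + y B_{n+1} + T_{n+1}$ leaves a recurrence in $T$ alone. *)
Lemma catalan_gfSSS n : catalan_gf p n.+3 =
  2 * catalan_gf p n.+2 - catalan_gf p n.+1 + fps_var * catalan_gf p n.+1.
Proof.
rewrite !catalan_gfS !(weight_all, weight_ends0S, weight_not_ends0S).
by ring.
Qed.

Lemma catalan_gf_fraction : catalan_gf p =
  (1 - var_x + var_x ^+ 2 - var_x ^+ 2 * var_y) /
  (1 - 2%:R * var_x + var_x ^+ 2 - var_x ^+ 2 * var_y).
Proof.
set F := catalan_gf p; set D := (X in _ / X).
have D_unit : D \is a GRing.unit.
  (* This form shows the constant term 1, which makes the denominator a unit. *)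
  have -> : D = 1 - var_x * (2%:R - var_x + var_x * var_y) by rewrite /D; ring.
  suff : fps_unit (1 - var_x * (2%:R - var_x + var_x * var_y)) by [].
  by rewrite /fps_unit fpsD fpsN fps1 fps_varM subr0 unitr1.
apply: (canRL (mulrK D_unit)).
(* Nesting the multiplications by [var_x] lets [fps_varM] read each coefficient as a shift. *)
have -> : F * D = F - var_x * (F + F - var_x * (F - var_y * F)).
  by rewrite /D; ring.
have -> : 1 - var_x + var_x ^+ 2 - var_x ^+ 2 * var_y =
  1 - var_x * (1 - var_x * (1 - var_y * 1)) by ring.
(* The recurrence governs the coefficients from index 3 on; the first three come from the initial
   values. *)
apply: fpsP => -[|[|[|n]]]; rewrite !(fpsD, fpsN, fps_varM, Defs.fps_constM, fps1) /F.
- by rewrite catalan_gf0.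
- by rewrite catalan_gf0 catalan_gf1 /=; ring.
- by rewrite catalan_gf0 catalan_gf1 catalan_gf2 /=; ring.
- by rewrite catalan_gfSSS /=; ring.
Qed.

End Avoiders.

Local Open Scope nat_scope.

(** * Avoidance of 001 under the two operations *)

Lemma catalan_prefix (u : seq nat) x : catalan (rcons u x) -> catalan u.
Proof. by case: u => // a u; rewrite catalan_rcons // => /andP[]. Qed.

Lemma avoids001_prefix (u : seq nat) x :
  avoids (rcons u x) [:: 0; 0; 1] -> avoids u [:: 0; 0; 1].
Proof.
apply: contra => /contains001P[i [j [k [ij jk ku wij wjk]]]].
apply/contains001P; exists i, j, k.
have ju := ltn_trans jk ku; have iu := ltn_trans ij ju.
by rewrite size_rcons !nth_rcons ku ju iu; split=> //; apply: ltnW.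
Qed.

(** An appended 0 could only play the final, largest letter of 001, but it exceeds nothing. *)
Lemma avoids001_rcons0 (u : seq nat) :
  avoids u [:: 0; 0; 1] -> avoids (rcons u 0) [:: 0; 0; 1].
Proof.
apply: contra => /contains001P[i [j [k []]]]; rewrite size_rcons ltnS => ij jk ku.
have ju := leq_trans jk ku; have iu := ltn_trans ij ju.
rewrite !nth_rcons ju iu => wij.
case: (ltnP k (size u)) => [ku' wjk|_]; last by rewrite if_same.
by apply/contains001P; exists i, j, k.
Qed.

(** All letters after the leading 0 are positive, so that 0 has no equal partner and takes part in
    no occurrence. *)
Lemma avoids001_cons0_mapS (u : seq nat) :
  avoids (0 :: map succn u) [:: 0; 0; 1] = avoids u [:: 0; 0; 1].
Proof.
congr negb; apply/contains001P/contains001P => -[i [j [k []]]].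
  case: k j => [|k] [|j] //=; rewrite !ltnS size_map => ij jk ku.
  have ju := ltn_trans jk ku.
  rewrite !(nth_map 0) //; case: i => [|i] //= in ij *.
  have iu : i < size u := ltn_trans ij ju.
  by rewrite (nth_map 0) // => -[wij] wjk; exists i, j, k.
move=> ij jk ku wij wjk; exists i.+1, j.+1, k.+1 => /=.
have ju := ltn_trans jk ku; have iu := ltn_trans ij ju.
by rewrite size_map !(nth_map 0) // wij.
Qed.

Lemma avoids001_cons0 (v : seq nat) : avoids (0 :: v) [:: 0; 0; 1] ->
  0 < last 0 v -> 0 \notin v.
Proof.
move=> av lastv; apply: contra av => v0; apply/contains001P.
have jv : index 0 v < size v by rewrite index_mem.
have kv : (size v).-1 < size v by lia.
(* The occurrence consists of the leading 0, the first 0 of [v] and the positive last letter. *)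
exists 0, (index 0 v).+1, (size v).-1.+1; rewrite /= nth_last !nth_index //.
split=> //; rewrite ltnS ltn_neqAle; apply/andP; split; last by lia.
by apply: contraTN lastv => /eqP jE; rewrite -nth_last -jE nth_index.
Qed.

(** * The generating functions for the two patterns *)

Lemma catalan_gf_012 : catalan_gf [:: 0; 1; 2] =
  ((1 - var_x + var_x ^+ 2 - var_x ^+ 2 * var_y) /
   (1 - 2%:R * var_x + var_x ^+ 2 - var_x ^+ 2 * var_y))%R.
Proof.
apply: (catalan_gf_fraction _ (rcons^~ 1)); try by rewrite catalan_avoids012.
- move=> [|a u] // _; rewrite !catalan_avoids012 /= => /and3P[-> ->].
  by rewrite all_rcons.
- move=> [|a u] // _; rewrite !catalan_avoids012 /= => /and3P[-> ->].
  by rewrite all_rcons.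
- case/lastP => // -[//|a u] x _; rewrite catalan_avoids012 all_rcons.
  rewrite rcons_cons [head _ _]/= => /and3P[a0 x1 au].
  exists (a :: u); first by rewrite catalan_avoids012 a0.
  (* The last letter, 0 or 1, tells which operation produced the word. *)
  by case: x x1 => [|[|]] // _; [left | right].
- by move=> u; rewrite size_rcons.
- exact: rcons_injl.
- by move=> u _; rewrite last_rcons.
- move=> u u_neq0; rewrite catalan_avoids012 descents_rcons // => /andP[_ le1].
  suff /negbTE -> : ~~ (1 < last 0 u) by rewrite addn0.
  rewrite -leqNgt; case: u le1 u_neq0 => // a u /allP le1 _.
  exact/le1/mem_last.
Qed.

Lemma catalan_gf_001 : catalan_gf [:: 0; 0; 1] =
  ((1 - var_x + var_x ^+ 2 - var_x ^+ 2 * var_y) /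
   (1 - 2%:R * var_x + var_x ^+ 2 - var_x ^+ 2 * var_y))%R.
Proof.
have avoids_short w : size w < 3 -> avoids w [:: 0; 0; 1].
  by move=> w3; apply/contains001P => -[i [j [k [ij jk kw _ _]]]]; lia.
apply: (catalan_gf_fraction _ (fun u => 0 :: map succn u)).
- by rewrite avoids_short.
- by rewrite avoids_short.
- move=> u u_neq0 /andP[u_cat u_av].
  by rewrite catalan_rcons // u_cat avoids001_rcons0.
- move=> u u_neq0 /andP[u_cat u_av].
  by rewrite catalan_cons0_mapS // u_cat avoids001_cons0_mapS.
- move=> w w_size /andP[w_cat w_av].
  (* A final 0 is removed; otherwise the leading 0 is removed and all remaining letters are lowered
     by 1. *)
  have [w0|w0] := posnP (last 0 w).
    case/lastP: w => // u x in w_size w_cat w_av w0 *.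
    rewrite last_rcons in w0; rewrite w0 in w_cat w_av *.
    exists u; last by left.
    by rewrite (catalan_prefix _ _ w_cat) (avoids001_prefix _ _ w_av).
  case: w => // a v in w_size w_cat w_av w0 *.
  have a0 : a = 0 by case/andP: w_cat => /eqP.
  subst a.
  have v0 := avoids001_cons0 _ w_av w0.
  (* Lowering the letters is reversible because [v] contains no 0. *)
  have vE : v = map succn (map predn v).
    rewrite -map_comp -[LHS]map_id; apply/eq_in_map => x xv /=.
    by rewrite prednK // lt0n; apply: contraNneq v0 => <-.
  have u_neq0 : map predn v != [::] by case: (v) w_size.
  exists (map predn v); last by right; rewrite -vE.
  by rewrite -catalan_cons0_mapS // -avoids001_cons0_mapS -vE w_cat.
- by move=> u; rewrite /= size_map.
- by move=> u v [] /(inj_map succn_inj).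
- by case=> // a u _; rewrite /= last_map.
- by move=> u _ _; rewrite descents_cons0_mapS.
Qed.

Local Open Scope ring_scope.

Theorem theorem4 (p : seq nat)
    (hp : p \in [:: [:: 0; 1; 2]; [:: 0; 0; 1]]%N) :
  catalan_gf p =
    (1 - var_x + var_x ^+ 2 - var_x ^+ 2 * var_y) /
    (1 - 2%:R * var_x + var_x ^+ 2 - var_x ^+ 2 * var_y).
Proof.
move: hp; rewrite !inE => /orP[] /eqP ->.
  exact: catalan_gf_012.
exact: catalan_gf_001.
Qed.
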